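(* Let $P$ be a standard Young tableau with exactly two columns, with first column $1,\dots,a$ from top to bottom (top entry $1$, bottom entry $a$) and second column $b,\dots,c$ from top to bottom (top entry $b$, bottom entry $c$). Consider the conditions: (1) all the entries below $b$ in the second column are larger than $a$; (2) there exist entries below $b$ in the second column that are smaller than $a$, and, denoting by $d$ the largest such entry, every entry of the first column which is smaller than $d$ is also smaller than $b$. If $P$ satisfies (1) or (2), then the Kazhdan--Lusztig right cell $\mathcal{C}_R(P)$ contains at least one smooth element. More precisely, the column word $\pi_P^c=(a,\dots,1,c,\dots,b)$ of $P$ is smooth if and only if (1) or (2) holds.
   Context: Permutations $w\in S_n$ are written in one-line notation $w=(w_1,\dots,w_n)$. $P(w)$ denotes the Robinson--Schensted (row) insertion tableau of $w$. Two elements of $S_n$ are in the same Kazhdan--Lusztig right cell if and only if they have the same insertion tableau; for a standard Young tableau $P$ with $n$ boxes, $\mathcal{C}_R(P)=\{w\in S_n: P(w)=P\}$ is the corresponding right cell. The column word of $P$ is the permutation obtained by reading the columns of $P$ from left to right, each column being read from bottom to top. In ''$1,\dots,a$'' and ''$b,\dots,c$'' the columns are increasing sequences whose entries need not be consecutive integers. An element $w\in S_n$ contains the pattern $3412$ (resp. $4231$) if there are indices $i<j<k<l$ with $w_k<w_l<w_i<w_j$ (resp. $w_l<w_j<w_k<w_i$). The element $w$ is smooth if the Schubert variety $X_w=\overline{BwB/B}$ of type $A$ is smooth; equivalently, if $w$ contains neither $3412$ nor $4231$. *)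

(* Defs.v *)
From mathcomp Require Import all_boot all_order all_fingroup.

Set Implicit Arguments.
Unset Strict Implicit.
Unset Printing Implicit Defensive.

(* A tableau is the list of its rows, from top to bottom (English notation),
   each row being listed from left to right. *)
Definition tableau := seq (seq nat).

Implicit Types (P T : tableau).

Definition num_columns P : nat := size (head [::] P).

(* Columns are numbered from 0; entries are listed from top to bottom. *)
Definition column P (j : nat) : seq nat :=
  [seq nth 0 r j | r <- P & j < size r].

(* The third and fourth conditions state that the shape is a partition. *)
Definition is_standard (n : nat) P : bool :=
  [&& all (sorted ltn) P,
      all (fun j => sorted ltn (column P j)) (iota 0 (num_columns P)),
      all (fun r => 0 < size r) P,
      sorted geq (map size P)
    & perm_eq (flatten P) (iota 1 n)].

Definition column_word P : seq nat :=
  flatten [seq rev (column P j) | j <- iota 0 (num_columns P)].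

(* 'S_n acts on {0, ..., n-1}; the one-line notation uses {1, ..., n}. *)
Definition one_line n (w : 'S_n) : seq nat := [seq (w i).+1 | i <- enum 'I_n].

(* [x] replaces (bumps) the leftmost entry of the row that is larger than it,
   and the bumped entry is inserted into the next row; if there is no such
   entry, [x] is appended to the row. *)
Fixpoint row_insert T (x : nat) : tableau :=
  if T is r :: T' then
    if has (ltn x) r then
      let i := find (ltn x) r in
      set_nth 0 r i x :: row_insert T' (nth 0 r i)
    else rcons r x :: T'
  else [:: [:: x]].

Definition insertion_tableau n (w : 'S_n) : tableau :=
  foldl row_insert [::] (one_line w).

Definition right_cell n P : {set 'S_n} := [set w | insertion_tableau w == P].

Definition contains_3412 n (w : 'S_n) : Prop :=
  exists i j k l : 'I_n,
    [/\ i < j, j < k & k < l] /\ [/\ w k < w l, w l < w i & w i < w j].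

Definition contains_4231 n (w : 'S_n) : Prop :=
  exists i j k l : 'I_n,
    [/\ i < j, j < k & k < l] /\ [/\ w l < w j, w j < w k & w k < w i].

(* Smoothness of the Schubert variety of [w] in type A, expressed by pattern
   avoidance (Lakshmibai-Sandhya). *)
Definition smooth n (w : 'S_n) : Prop :=
  ~ contains_3412 w /\ ~ contains_4231 w.

(* Main.v *)
Require Import Defs.
From mathcomp Require Import all_boot all_order all_fingroup.

(** Write [c0] and [c1] for the two columns of [P] and [pi] for the permutation
    with one-line notation [rev c0 ++ rev c1].

    Smoothness.  The word of [pi] is a concatenation of two decreasing words, so
    every ascent goes from the first word to the second.  The pattern 3412 has
    two disjoint ascents, the second one starting after the end of the first, so
    it never occurs.  The pattern 4231 has its single ascent in the middle, so
    an occurrence amounts to [x], [y] in [c0] and [u], [v] in [c1] with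
    [v < y < u < x] ([contains_4231_cat_decreasing]).  Such a quadruple can
    always be enlarged to one with [x] the bottom entry [a] of [c0], [v] the top
    entry [b] of [c1], and [u] the largest entry of [c1] smaller than [a].
    The absence of a quadruple of this last form is exactly the disjunction of
    the two conditions ([crossing_free_columns]).

    Membership in the cell.  Insert the entries of a column from bottom to top
    into a tableau all of whose rows stay to the left of that column: each new
    entry lands at the end of the first row, and the entries of the column
    inserted before it move down by one row, as each of them is smaller than the
    one below it ([insert_column]).  So inserting the column word rebuilds the
    tableau column by column, and [pi] itself is the smooth element of the
    cell. *)

Set Implicit Arguments.
Unset Strict Implicit.
Unset Printing Implicit Defensive.

(** * Inserting the column word of a tableau *)

(** When [s] is longer than [T], the excess entries form new rows rather than
    being dropped: a one-column tableau is then the case of an empty [T], and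
    one insertion lemma serves for both columns. *)
Fixpoint add_column (T : tableau) (s : seq nat) : tableau :=
  match T, s with
  | r :: T', y :: s' => rcons r y :: add_column T' s'
  | _ :: _, [::] => T
  | [::], _ => [seq [:: y] | y <- s]
  end.

Lemma add_column_nil T : add_column T [::] = T.
Proof. by case: T. Qed.

Lemma perm_flatten_add_column T s :
  perm_eq (flatten (add_column T s)) (flatten T ++ s).
Proof.
elim: T s => [|r T IHT] [|y s] //=; first by rewrite flatten_map1 map_id.
  by rewrite cats0.
rewrite cat_rcons -catA perm_cat2l.
by rewrite perm_sym -[y :: s]cat1s perm_catCA /= perm_cons perm_sym IHT.
Qed.

Lemma sorted_ltn_rcons r y :
  sorted ltn (rcons r y) = sorted ltn r && all (ltn^~ y) r.
Proof.
rewrite -(rev_sorted gtn) rev_rcons /= path_sortedE; last first.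
  by move=> p q t /= qp tq; apply: ltn_trans qp.
by rewrite all_rev rev_sorted andbC.
Qed.

Lemma find_rcons_last (T : Type) (p : pred T) r z :
  ~~ has p r -> p z -> find p (rcons r z) = size r.
Proof. by move=> pr pz; rewrite -cats1 find_cat (negPf pr) /= pz addn0. Qed.

Lemma set_nth_rcons_last (T : Type) (x0 : T) r z y :
  set_nth x0 (rcons r z) (size r) y = rcons r y.
Proof. by elim: r => //= u r ->. Qed.

(** Every entry of the first row that belongs to [T] is smaller than [y], so only
    the last one, from [s], is bumped.  It is then inserted into the next row,
    where the same situation recurs with the bumped entry in place of [y]. *)
Lemma row_insert_add_column T y s :
    path ltn y s -> all (sorted ltn) (add_column T (y :: s)) ->
  row_insert (add_column T s) y = add_column T (y :: s).
Proof.
elim: T y s => [|r T IHT] y s.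
  elim: s y => //= z s IHs y /andP[yz zs] _.
  by rewrite /= yz /= IHs // all_map; apply/allP.
have not_bumped t: all (ltn^~ t) r -> ~~ has (ltn t) r.
  by rewrite -all_predC; apply: sub_all => u /= ut; rewrite -leqNgt ltnW.
case: s => [_|z s] /=.
  rewrite sorted_ltn_rcons => /andP[/andP[_ /not_bumped/negPf->] _].
  by rewrite add_column_nil.
case/andP=> yz zs; rewrite sorted_ltn_rcons => /andP[/andP[_ ry] Tzs].
rewrite has_rcons /= yz /= find_rcons_last ?not_bumped //.
rewrite nth_rcons ltnn eqxx IHT //; congr (_ :: _).
exact: set_nth_rcons_last.
Qed.

(** Moving the entries of the added column up by one row keeps the rows
    increasing, because each entry is replaced by a larger one. *)
Lemma add_column_behead_sorted T y s :
    path ltn y s -> all (sorted ltn) (add_column T (y :: s)) ->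
  all (sorted ltn) (add_column T s).
Proof.
elim: T y s => [|r T IHT] y s; first by move=> _ /=.
case: s => [|z s] /=.
  by rewrite add_column_nil sorted_ltn_rcons => _ /andP[/andP[-> _] ->].
case/andP=> yz zs; rewrite !sorted_ltn_rcons => /andP[/andP[-> ry] Tzs] /=.
rewrite (IHT _ _ zs Tzs) andbT; apply: sub_all ry => u uy.
exact: ltn_trans uy yz.
Qed.

Lemma insert_column T s :
    sorted ltn s -> all (sorted ltn) (add_column T s) ->
  foldl row_insert T (rev s) = add_column T s.
Proof.
elim: s => [|y s IHs] ys rows; first by rewrite add_column_nil.
rewrite rev_cons foldl_rcons IHs ?(path_sorted ys) //.
  exact: row_insert_add_column.
exact: add_column_behead_sorted rows.
Qed.

Lemma size_row_le_num_columns P :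
  sorted geq (map size P) -> all (fun r => size r <= num_columns P) P.
Proof.
case: P => //= r P; rewrite path_sortedE => [/andP[sizes _]|]; last first.
  by move=> p q t /= qp tq; apply: leq_trans qp.
by rewrite /num_columns /= leqnn -[all _ _](all_map size (geq (size r))).
Qed.

Lemma two_columnsE P :
    all (fun r => 0 < size r <= 2) P -> sorted geq (map size P) ->
  P = add_column (add_column [::] (column P 0)) (column P 1).
Proof.
elim: P => [|r P IHP] //= /andP[r12 P12] rP.
have {IHP} defP := IHP P12 (path_sorted rP).
case: r r12 rP => [|x [|y [|z r]]] //= _ rP; last first.
  by rewrite {1}defP.
(* A row of length 1 has only rows of length 1 below it. *)
have P1: column P 1 = [::].
  rewrite /column (eq_in_filter (a2 := pred0)) ?filter_pred0 // => t tP.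
  have /allP := @size_row_le_num_columns ([:: x] :: P) rP.
  by move/(_ t); rewrite inE tP orbT /= ltnNge => ->.
rewrite -[column (_ :: P) 1]/(column P 1) P1.
by rewrite P1 add_column_nil in defP; rewrite {1}defP.
Qed.

(** * Permutations and their one-line notation *)

Lemma one_line_exists n s :
  perm_eq s (iota 1 n) -> exists w : 'S_n, one_line w = s.
Proof.
case/(tuple_permP (t := iota_tuple n 1))=> w ->; exists w.
apply: eq_map => i; rewrite (tnth_nth 0) /=.
by rewrite nth_iota.
Qed.

Lemma size_one_line n (w : 'S_n) : size (one_line w) = n.
Proof. by rewrite size_map size_enum_ord. Qed.

Lemma nth_one_line n (w : 'S_n) (i : 'I_n) : nth 0 (one_line w) i = (w i).+1.
Proof. by rewrite (nth_map i) ?size_enum_ord // nth_ord_enum. Qed.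

Lemma sorted_gtn_nth s i j :
  sorted gtn s -> i < j < size s -> nth 0 s j < nth 0 s i.
Proof.
move=> s_dec /andP[ij js].
apply: (sorted_ltn_nth _ 0 s_dec) => //; last by rewrite inE (ltn_trans ij).
by move=> p q t /= qp tq; apply: ltn_trans qp.
Qed.

Lemma sorted_gtn_index s x y :
  sorted gtn s -> x \in s -> y \in s -> y < x -> index x s < index y s.
Proof.
move=> s_dec xs ys yx; rewrite ltnNge leq_eqVlt; apply/negP => /orP[/eqP e|yxs].
  by move: yx; rewrite -[x in _ < x](nth_index 0 xs) -e nth_index ?ltnn.
have := @sorted_gtn_nth s _ _ s_dec.
move/(_ (index y s) (index x s)); rewrite yxs index_mem xs !nth_index // => /(_ isT).
by rewrite ltnNge (ltnW yx).
Qed.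

Section TwoDecreasingWords.

Variables (n : nat) (w : 'S_n) (s t : seq nat).
Hypotheses (w_st : one_line w = s ++ t).
Hypotheses (s_dec : sorted gtn s) (t_dec : sorted gtn t).

Let ord_size (i : 'I_n) : i < size s + size t.
Proof. by rewrite -size_cat -w_st size_one_line. Qed.

Lemma ascent_across (i j : 'I_n) : i < j -> w i < w j -> i < size s <= j.
Proof.
move=> ij; rewrite -ltnS -!nth_one_line w_st !nth_cat.
have [js|sj] := ltnP j (size s).
  rewrite (ltn_trans ij js) => wij.
  by have:= @sorted_gtn_nth s i j s_dec; rewrite ij js ltnNge (ltnW wij) => /(_ isT).
have [//|si wij] := ltnP i (size s).
have:= @sorted_gtn_nth t (i - size s) (j - size s) t_dec.
rewrite ltn_sub2rE // ij ltn_subLR // ord_size ltnNge (ltnW wij).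
by move=> /(_ isT).
Qed.

Lemma cat_decreasing_avoids_3412 : ~ contains_3412 w.
Proof.
case=> i [j [k [l [[ij jk kl] [wkl wli wij]]]]].
have /andP[_ sj] := ascent_across ij wij.
have /andP[ks _] := ascent_across kl wkl.
by move: (leq_trans ks sj); rewrite ltnNge (ltnW jk).
Qed.

Lemma contains_4231_cat_decreasing :
  contains_4231 w <->
  exists x y u v, [/\ x \in s, y \in s, u \in t & v \in t] /\
                  [/\ v < y, y < u & u < x].
Proof.
have in_s (i : 'I_n): i < size s -> (w i).+1 \in s.
  by move=> i_s; rewrite -nth_one_line w_st nth_cat i_s mem_nth.
have in_t (i : 'I_n): size s <= i -> (w i).+1 \in t.
  move=> si; rewrite -nth_one_line w_st nth_cat ltnNge si /= mem_nth //.
  by rewrite ltn_subLR ?ord_size.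
split=> [[i [j [k [l [[ij jk kl] [wlj wjk wki]]]]]]|].
  have /andP[js sk] := ascent_across jk wjk.
  exists (w i).+1, (w j).+1, (w k).+1, (w l).+1; rewrite !ltnS.
  split; split=> //; [apply: in_s | apply: in_s | apply: in_t | apply: in_t] => //.
    exact: ltn_trans ij js.
  exact: leq_trans sk (ltnW kl).
case=> x [y [u [v [[xs ys ut vt] [vy yu ux]]]]].
have size_st: size s + size t = n by rewrite -size_cat -w_st size_one_line.
have s_ord z: z \in s -> exists2 i : 'I_n, val i = index z s & (w i).+1 = z.
  move=> zs; have i_s: index z s < size s by rewrite index_mem.
  have i_n: index z s < n by rewrite -size_st ltn_addr.
  exists (Ordinal i_n) => //.
  by rewrite -nth_one_line w_st nth_cat /= i_s nth_index.
have t_ord z: z \in t ->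
    exists2 i : 'I_n, val i = size s + index z t & (w i).+1 = z.
  move=> zt; have i_n: size s + index z t < n.
    by rewrite -size_st ltn_add2l index_mem.
  exists (Ordinal i_n) => //.
  by rewrite -nth_one_line w_st nth_cat /= ltnNge leq_addr /= addKn nth_index.
have [i iE wi] := s_ord x xs; have [j jE wj] := s_ord y ys.
have [k kE wk] := t_ord u ut; have [l lE wl] := t_ord v vt.
have wE (p q : 'I_n): (w p < w q) = ((w p).+1 < (w q).+1) by [].
exists i, j, k, l; rewrite !wE wi wj wk wl iE jE kE lE ltn_add2l; split; split=> //.
- by apply: sorted_gtn_index => //; apply: ltn_trans yu ux.
- by rewrite ltn_addr // index_mem.
- by apply: sorted_gtn_index => //; apply: ltn_trans vy yu.
Qed.

End TwoDecreasingWords.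

(** * Crossing columns *)

(** When there is no crossing and the first condition fails, the bound required
    by the second one comes from the extremal crossing: if [d] is the largest
    entry of [c1] with [d < a], an entry [x] of [c0] with [b < x < d] would give
    the crossing [b < x < d < a]. *)
Lemma crossing_free_columns (c0 c1 : seq nat) :
    sorted ltn c0 -> sorted ltn c1 -> c0 != [::] -> uniq (c0 ++ c1) ->
  let a := last 0 c0 in
  let b := head 0 c1 in
  ~ (exists x y u v, [/\ x \in c0, y \in c0, u \in c1 & v \in c1] /\
                     [/\ v < y, y < u & u < x]) <->
  (forall y, y \in behead c1 -> a < y) \/
  exists d, [/\ d \in behead c1, d < a,
                forall y, y \in behead c1 -> y < a -> y <= d
              & forall x, x \in c0 -> x < d -> x < b].
Proof.
case: c0 => // x0 c0; case: c1 => [|b c1] c0_inc c1_inc _ /=.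
  by move=> _; split=> [_|_ [? [? [? [? [[]]]]]]] //; left.
move=> c01_uniq; set a := last x0 c0.
have a_in: a \in x0 :: c0 by apply: mem_last.
have a_max x: x \in x0 :: c0 -> x <= a.
  move=> x_in; have:= c0_inc; rewrite /= => c0_path.
  have: sorted ltn (rcons (belast x0 c0) a) by rewrite -lastI.
  rewrite sorted_ltn_rcons => /andP[_ /allP a_gt].
  by move: x_in; rewrite lastI mem_rcons inE => /predU1P[-> // | /a_gt/ltnW].
have b_min v: v \in b :: c1 -> b <= v.
  move: c1_inc; rewrite /= path_sortedE; last exact: ltn_trans.
  by case/andP=> /allP b_lt _; rewrite inE => /predU1P[-> // | /b_lt/ltnW].
have disjoint_cols x: x \in x0 :: c0 -> x \notin b :: c1.
  move=> xc0; apply/negP => xc1.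
  have: uniq ((x0 :: c0) ++ b :: c1) := c01_uniq.
  by rewrite cat_uniq => /and3P[_ /hasP[]]; exists x.
split=> [no_crossing | conds].
- have [c1_gt|] := boolP (all (ltn a) c1); first by left=> y; apply: (allP c1_gt).
  rewrite -has_predC => /hasP[d0 d0c1 /=]; rewrite -leqNgt => d0a.
  have lt_a u: u \in c1 -> u <= a -> u < a.
    move=> uc1; rewrite leq_eqVlt => /predU1P[ua|//].
    by have:= disjoint_cols a a_in; rewrite -ua inE uc1 orbT.
  right; have ex_d: exists d, (d \in c1) && (d < a) by exists d0; rewrite d0c1 lt_a.
  have d_le u: (u \in c1) && (u < a) -> u <= a by case/andP=> _ /ltnW.
  have [d /andP[dc1 da] d_max] := ex_maxnP ex_d d_le.
  exists d; split=> // [y yc1 ya | x xc0 xd]; first by apply: d_max; rewrite yc1.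
  rewrite ltnNge leq_eqVlt; apply/negP => /predU1P[bx|bx].
    by have:= disjoint_cols x xc0; rewrite -bx inE eqxx.
  apply: no_crossing; exists a, x, d, b; do 2!split=> //.
    by rewrite inE dc1 orbT.
  by rewrite inE eqxx.
- case=> x [y [u [v [[xc0 yc0 uc1 vc1] [vy yu ux]]]]].
  have bv := b_min v vc1; have ua := leq_trans ux (a_max x xc0).
  have {uc1} uc1: u \in c1.
    move: uc1; rewrite inE => /predU1P[ub|//].
    by move: (leq_ltn_trans bv (ltn_trans vy yu)); rewrite ub ltnn.
  case: conds => [/(_ u uc1) au | [d [_ _ d_max below_d]]].
    by move: (ltn_trans ua au); rewrite ltnn.
  have yb := below_d y yc0 (leq_trans yu (d_max u uc1 ua)).
  by move: (ltn_trans (leq_ltn_trans bv vy) yb); rewrite ltnn.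
Qed.

(** * The column word of a two-column tableau *)

Theorem proposition5p1 (n : nat) (P : tableau)
    (P_standard : is_standard n P) (P_two_columns : num_columns P = 2) :
  let a := last 0 (column P 0) in
  let b := head 0 (column P 1) in
  let below_b := behead (column P 1) in
  let cond1 := forall y : nat, y \in below_b -> a < y in
  let cond2 :=
    exists d : nat, [/\ d \in below_b, d < a,
                  forall y : nat, y \in below_b -> y < a -> y <= d
                & forall x : nat, x \in column P 0 -> x < d -> x < b] in
  (cond1 \/ cond2 -> exists2 w : 'S_n, w \in right_cell n P & smooth w) /\
  (exists2 pi : 'S_n, one_line pi = column_word P
     & (smooth pi <-> cond1 \/ cond2)).
Proof.
move=> a b below_b cond1 cond2.
case/and5P: P_standard => rows; rewrite P_two_columns /= => /and3P[c0_inc c1_inc _].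
move=> rows_gt0 shape P_iota.
have sizes: all (fun r => 0 < size r <= 2) P.
  by rewrite all_predI rows_gt0 -P_two_columns size_row_le_num_columns.
have defP := two_columnsE sizes shape.
have c0_neq0: column P 0 != [::] by case: (P) P_two_columns => [|[]].
move: c0_inc c1_inc c0_neq0 defP.
have P_word: column_word P = rev (column P 0) ++ rev (column P 1).
  by rewrite /column_word P_two_columns /= cats0.
pose c0 := column P 0; pose c1 := column P 1.
rewrite -/c0 -/c1 in P_word *; move=> c0_inc c1_inc c0_neq0 defP.
have cols_iota: perm_eq (c0 ++ c1) (iota 1 n).
  rewrite -(permPr P_iota) defP perm_sym.
  rewrite (permPl (perm_flatten_add_column _ _)) perm_cat2r.
  exact: perm_flatten_add_column.
have cols_uniq: uniq (c0 ++ c1) by rewrite (perm_uniq cols_iota) iota_uniq.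
have [|pi pi_word] := @one_line_exists n (rev c0 ++ rev c1).
  by rewrite -(permPr cols_iota) perm_cat // perm_rev.
have pi_smooth: smooth pi <-> cond1 \/ cond2.
  have d0: sorted gtn (rev c0) by rewrite rev_sorted.
  have d1: sorted gtn (rev c1) by rewrite rev_sorted.
  have pat := contains_4231_cat_decreasing pi_word d0 d1.
  have free := crossing_free_columns c0_inc c1_inc c0_neq0 cols_uniq.
  split=> [[_ no_4231] | conds].
    apply/free => - [x [y [u [v [mems ineqs]]]]]; apply/no_4231/pat.
    by exists x, y, u, v; rewrite !mem_rev.
  split; first exact: cat_decreasing_avoids_3412 pi_word d0 d1.
  move/pat=> [x [y [u [v []]]]]; rewrite !mem_rev => mems ineqs.
  by case/free: conds; exists x, y, u, v.
split; last by exists pi; rewrite ?P_word.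
move/pi_smooth=> smooth_pi; exists pi => //.
have one_column_rows: all (sorted ltn) (add_column [::] c0).
  by rewrite /= all_map; apply/allP.
rewrite inE /insertion_tableau pi_word foldl_cat (insert_column c0_inc one_column_rows).
by rewrite insert_column -?defP.
Qed.
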